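(* Let $G(k)=\sum_{j=0}^{k-1}\frac{1}{(2j+1)^2}$ for integers $k\ge 0$. For all even integers $n\geq 0$ we have $$\sum_{k=0}^\infty\frac{\binom{2k}{k}G(k)}{4^k(2k+1+n)} =\frac{\binom{n}{n/2}}{2^{n+3}}\left(\frac{\pi^3}{6} +\pi\sum_{j=1}^{\frac{n}{2}}\bigg(\frac{4^j}{\binom{2j}{j}}-1\bigg)\frac{1}{j^2}\right),$$ and for all odd integers $n\geq 1$, $$\sum_{k=0}^\infty\frac{\binom{2k}{k}G(k)}{4^k(2k+1+n)} =\frac{2^{n-1}}{n\binom{n-1}{\frac{n-1}{2}}}\left( \frac{\pi}{2}\sum_{j=0}^{\frac{n-1}{2}}\frac{\binom{2j}{j}}{(2j+1)4^j} -\sum_{j=0}^{\frac{n-1}{2}}\frac{1}{(2j+1)^2}\right).$$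
   Context: Empty sums are equal to $0$ (in particular $G(0)=0$). *)

(* Defs.v *)
From Stdlib Require Export Reals.
From Coquelicot Require Export Coquelicot.

Open Scope R_scope.

(* [sum_n u m] has the m + 1 terms u 0, ..., u m; the case k = 0 is the empty
   sum. *)
Definition G (k : nat) : R :=
  match k with
  | O => 0
  | S m => sum_n (fun j => 1 / (2 * INR j + 1) ^ 2) m
  end.

(* Coquelicot shadows [C] by the type of complex numbers. [Binomial.C n k] is
   the usual coefficient only for k <= n, which holds in every use here. *)
Notation binom := Binomial.C (only parsing).

(* Main.v *)
Require Import Defs.
From Stdlib Require Import Lra Lia.

(* Since [sum_k cb k * G k * x ^ (2 k) = arcsin x ^ 2 / (2 sqrt (1 - x ^ 2))],
   the substitution [x = sin t] in [1 / (2 k + 1 + n) = int_0^1 x ^ (2 k + n) dx]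
   shows that the series equals [int_0^(PI / 2) t ^ 2 / 2 * sin t ^ n dt].
   Truncating at [N] leaves a remainder [rem2] that is nonnegative, and whose
   integral is at most [3 cb (N + 1) G (N + 1) + 2 cb (N + 1)], which tends to 0.
   Integration by parts lowers [n] by 2 in the integral at the cost of a Wallis
   integral, which yields the two closed forms by induction from [n = 0, 1]. *)

(** * Normalised central binomial coefficients: recurrence and decay *)

Definition cb (k : nat) : R := binom (2 * k) k / 4 ^ k.

Lemma cb_0 : cb 0 = 1.
Proof. unfold cb, Binomial.C; simpl; field. Qed.

Lemma cb_S (k : nat) :
  cb (S k) = cb k * ((2 * INR k + 1) / (2 * INR k + 2)).
Proof.
  unfold cb, Binomial.C.
  replace (2 * S k - S k)%nat with (S k) by lia.
  replace (2 * k - k)%nat with k by lia.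
  replace (2 * S k)%nat with (S (S (2 * k))) by lia.
  rewrite !fact_simpl, !mult_INR, !S_INR, mult_INR.
  change (4 ^ S k) with (4 * 4 ^ k).
  assert (H := pos_INR k).
  assert (H1 := INR_fact_neq_0 k).
  assert (H2 : 4 ^ k <> 0) by (apply pow_nonzero; lra).
  simpl (INR 2). field; repeat split; lra.
Qed.

Lemma cb_pos (k : nat) : 0 < cb k.
Proof.
  induction k as [|k IH]; [rewrite cb_0; lra|].
  assert (H := pos_INR k).
  rewrite cb_S; apply Rmult_lt_0_compat; [exact IH|].
  apply Rdiv_lt_0_compat; lra.
Qed.

(** The left side is nonincreasing in [k], because [(2 k + 1) (2 k + 3) <= (2 k + 2) ^ 2], and it
    equals 1 at [k = 0]. This gives decay of order [1 / sqrt k] without Stirling's formula. *)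
Lemma cb_sqr_le (k : nat) : cb k ^ 2 * (2 * INR k + 1) <= 1.
Proof.
  induction k as [|k IH]; [rewrite cb_0; simpl; lra|].
  assert (H := pos_INR k).
  rewrite cb_S, S_INR.
  replace ((cb k * ((2 * INR k + 1) / (2 * INR k + 2))) ^ 2
           * (2 * (INR k + 1) + 1))
    with ((cb k ^ 2 * (2 * INR k + 1))
          * ((2 * INR k + 1) * (2 * INR k + 3) / (2 * INR k + 2) ^ 2))
    by (field; lra).
  assert (0 <= cb k ^ 2 * (2 * INR k + 1)).
  { apply Rmult_le_pos; [apply pow2_ge_0 | lra]. }
  assert ((2 * INR k + 1) * (2 * INR k + 3) / (2 * INR k + 2) ^ 2 <= 1).
  { apply Rle_div_l; nra. }
  nra.
Qed.

Lemma is_lim_seq_cb : is_lim_seq cb 0.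
Proof.
  apply is_lim_seq_spec; intros eps.
  assert (He := cond_pos eps).
  (* Beyond [/ eps ^ 2], having [eps <= cb n] would contradict [cb_sqr_le]. *)
  destruct (nfloor_ex (/ (eps * eps))) as [N [_ HN]].
  { left; apply Rinv_0_lt_compat; nra. }
  exists (S N); intros n Hn.
  assert (Hp := cb_pos n). assert (Hs := cb_sqr_le n).
  apply le_INR in Hn; rewrite S_INR in Hn.
  rewrite Rminus_0_r, Rabs_pos_eq by lra.
  apply Rnot_le_lt; intros Hle.
  assert (H1 : 1 < eps * eps * (INR N + 1)).
  { apply (Rmult_lt_compat_l (eps * eps)) in HN; [|nra].
    rewrite Rinv_r in HN; nra. }
  assert (eps * eps <= cb n ^ 2) by nra.
  assert (0 <= INR N) by apply pos_INR.
  nra.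
Qed.

(** * Recurrence and bounds for [G] *)

Lemma G_S (k : nat) : G (S k) = G k + 1 / (2 * INR k + 1) ^ 2.
Proof.
  destruct k as [|k].
  - change (G 1) with (sum_n (fun j => 1 / (2 * INR j + 1) ^ 2) 0).
    change (G 0) with 0.
    rewrite sum_O, Rplus_0_l; reflexivity.
  - unfold G; rewrite sum_Sn; reflexivity.
Qed.

Lemma G_ge_0 (k : nat) : 0 <= G k.
Proof.
  induction k as [|k IH]; [simpl; lra|].
  assert (H := pos_INR k).
  rewrite G_S; apply Rplus_le_le_0_compat; [exact IH|].
  left; apply Rdiv_lt_0_compat; [lra | apply pow_lt; lra].
Qed.

(** Telescoping: each new term is at most [1 / ((k + 1) (k + 2))]. The subtracted inverse
    strengthens the uniform bound 2 so that the induction goes through. *)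
Lemma G_S_le (k : nat) : G (S k) <= 2 - / (INR k + 1).
Proof.
  induction k as [|k IH]; [simpl; rewrite sum_O; simpl; lra|].
  assert (H := pos_INR k).
  rewrite G_S, S_INR.
  assert (1 / (2 * (INR k + 1) + 1) ^ 2 <= / (INR k + 1) - / (INR k + 1 + 1)); [|lra].
  replace (/ (INR k + 1) - / (INR k + 1 + 1))
    with (/ ((INR k + 1) * (INR k + 2))) by (field; lra).
  unfold Rdiv; rewrite Rmult_1_l; apply Rinv_le_contravar; nra.
Qed.

(** * Derivatives of truncated power series evaluated at [sin t] *)

Lemma is_derive_sin_pow (m : nat) (t : R) :
  is_derive (fun t => sin t ^ S m) t (INR (S m) * sin t ^ m * cos t).
Proof.
  auto_derive; [exact I |].
  change (1 * cos t * (INR (S m) * sin t ^ m) = INR (S m) * sin t ^ m * cos t); ring.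
Qed.

(** The factor [cos t] cancels the [1 / sqrt (1 - x ^ 2)] in the generating functions at
    [x = sin t], and is also the Jacobian of that substitution. *)
Definition cos_even (x : nat -> R) (N : nat) (t : R) : R :=
  cos t * sum_n (fun k => x k * sin t ^ (2 * k)) N.

Definition odd_sum (x : nat -> R) (N : nat) (t : R) : R :=
  sum_n (fun k => x k * sin t ^ (2 * k + 1)) N.

Lemma cos_even_S (x : nat -> R) (N : nat) (t : R) :
  cos_even x (S N) t = cos_even x N t + cos t * (x (S N) * sin t ^ S (S (2 * N))).
Proof.
  unfold cos_even; rewrite sum_Sn; change plus with Rplus.
  replace (2 * S N)%nat with (S (S (2 * N))) by lia. ring.
Qed.

Lemma odd_sum_S (x : nat -> R) (N : nat) (t : R) :
  odd_sum x (S N) t = odd_sum x N t + x (S N) * sin t ^ S (S (2 * N + 1)).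
Proof.
  unfold odd_sum; rewrite sum_Sn; change plus with Rplus.
  replace (2 * S N + 1)%nat with (S (S (2 * N + 1))) by lia. ring.
Qed.

(** With [cos ^ 2 = 1 - sin ^ 2], the [k]-th term has derivative [2 k x_k sin ^ (2 k - 1) - (2 k +
    1) x_k sin ^ (2 k + 1)]. Collecting equal powers pairs [x k] with [x (S k)]; the top power lacks
    its [x (S N)] part, hence the correction. *)
Lemma is_derive_cos_even (x : nat -> R) (N : nat) (t : R) :
  is_derive (cos_even x N) t
    (odd_sum (fun k => (2 * INR k + 2) * x (S k) - (2 * INR k + 1) * x k) N t
     - (2 * INR N + 2) * x (S N) * sin t ^ (2 * N + 1)).
Proof.
  induction N as [|N IH].
  - apply (is_derive_ext (fun t => cos t * x O)).
    { intros s; unfold cos_even; rewrite sum_O; simpl; ring. }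
    unfold odd_sum; rewrite sum_O; simpl INR; simpl pow.
    auto_derive; [exact I | ring].
  - apply (is_derive_ext
             (fun t => cos_even x N t + cos t * (x (S N) * sin t ^ S (S (2 * N))))).
    { intros s; symmetry; apply cos_even_S. }
    rewrite odd_sum_S.
    (* [l] is the derivative of the added term; unification fills it in below. *)
    evar (l : R).
    replace (_ - _) with
      ((odd_sum (fun k => (2 * INR k + 2) * x (S k) - (2 * INR k + 1) * x k) N t
        - (2 * INR N + 2) * x (S N) * sin t ^ (2 * N + 1)) + l).
    + apply (is_derive_plus (cos_even x N)); [exact IH|].
      apply (is_derive_mult cos (fun t => x (S N) * sin t ^ S (S (2 * N)))).
      * apply is_derive_cos.
      * apply is_derive_scal, is_derive_sin_pow.
      * intros; apply Rmult_comm.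
    + unfold l; change plus with Rplus; change mult with Rmult.
      replace (2 * S N + 1)%nat with (S (S (2 * N + 1))) by lia.
      replace (2 * N + 1)%nat with (S (2 * N)) by lia.
      rewrite !S_INR, mult_INR; simpl (INR 2).
      rewrite <- !tech_pow_Rmult.
      assert (Hc : cos t * cos t = 1 - sin t * sin t)
        by (assert (Hs := sin2_cos2 t); unfold Rsqr in Hs; lra).
      transitivity
        (odd_sum (fun k => (2 * INR k + 2) * x (S k) - (2 * INR k + 1) * x k) N t
         - (2 * INR N + 2) * x (S N) * (sin t * sin t ^ (2 * N))
         - x (S N) * sin t ^ (2 * N) * sin t * sin t * sin t
         + (2 * INR N + 2) * x (S N) * sin t ^ (2 * N) * sin t * (cos t * cos t));
        [ring | rewrite Hc; ring].
Qed.

Lemma is_derive_odd_sum (x : nat -> R) (N : nat) (t : R) :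
  is_derive (odd_sum (fun k => x k / (2 * INR k + 1)) N) t (cos_even x N t).
Proof.
  induction N as [|N IH].
  - apply (is_derive_ext (fun t => x O * sin t)).
    { intros s; unfold odd_sum; rewrite sum_O; simpl; field. }
    unfold cos_even; rewrite sum_O; simpl.
    auto_derive; [exact I | ring].
  - apply (is_derive_ext
             (fun t => odd_sum (fun k => x k / (2 * INR k + 1)) N t +
                x (S N) / (2 * INR (S N) + 1) * sin t ^ S (S (2 * N + 1)))).
    { intros s; rewrite odd_sum_S; reflexivity. }
    rewrite cos_even_S.
    apply (is_derive_plus (odd_sum _ N)); [exact IH|].
    replace (cos t * (x (S N) * sin t ^ S (S (2 * N)))) with
      (x (S N) / (2 * INR (S N) + 1)
       * (INR (S (S (2 * N + 1))) * sin t ^ S (2 * N + 1) * cos t)).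
    + apply is_derive_scal, is_derive_sin_pow.
    + replace (2 * N + 1)%nat with (S (2 * N)) by lia.
      rewrite !S_INR, mult_INR; simpl (INR 2).
      assert (H := pos_INR N). field; lra.
Qed.

Lemma cos_even_0 (x : nat -> R) (N : nat) : cos_even x N 0 = x O.
Proof.
  induction N as [|N IH].
  - unfold cos_even; rewrite sum_O, cos_0; simpl; ring.
  - rewrite cos_even_S, IH, sin_0; simpl; ring.
Qed.

Lemma odd_sum_0 (x : nat -> R) (N : nat) : odd_sum x N 0 = 0.
Proof.
  induction N as [|N IH].
  - unfold odd_sum; rewrite sum_O, sin_0; simpl; ring.
  - rewrite odd_sum_S, IH, sin_0; simpl; ring.
Qed.

Lemma nonneg_of_derive (f df : R -> R) (b : R) :
  (forall t, is_derive f t (df t)) -> f 0 = 0 ->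
  (forall t, 0 <= t <= b -> 0 <= df t) ->
  forall t, 0 <= t <= b -> 0 <= f t.
Proof.
  intros Hd H0 Hp t Ht.
  destruct (MVT_gen f 0 t df) as [c [Hc He]].
  - intros; apply Hd.
  - intros s _; apply derivable_continuous_pt.
    exists (df s); apply is_derive_Reals, Hd.
  - rewrite Rmin_left, Rmax_right in Hc by lra.
    rewrite H0 in He.
    assert (0 <= df c) by (apply Hp; lra). nra.
Qed.

(** * Coefficient recurrences, and signs of the series remainders *)

Definition cG (k : nat) : R := cb k * G k.

(** Coefficient form of the fact that [t ^ 2 / 2] has derivative [t]: the right side is the
    coefficient of [x ^ (2 k + 1)] in [arcsin x]. *)
Lemma cG_rec (k : nat) :
  (2 * INR k + 2) * cG (S k) - (2 * INR k + 1) * cG k = cb k / (2 * INR k + 1).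
Proof.
  unfold cG; rewrite cb_S, G_S; assert (H := pos_INR k); field; lra.
Qed.

(** Coefficient form of the fact that the constant 1 has derivative 0; only the truncation term is
    then left in the derivative of [rem0]. *)
Lemma cb_rec (k : nat) :
  (2 * INR k + 2) * cb (S k) - (2 * INR k + 1) * cb k = 0.
Proof. rewrite cb_S; assert (H := pos_INR k); field; lra. Qed.

Lemma odd_sum_ext (x y : nat -> R) (N : nat) (t : R) :
  (forall k, x k = y k) -> odd_sum x N t = odd_sum y N t.
Proof. intros H; apply sum_n_ext; intros k; rewrite H; reflexivity. Qed.

Lemma odd_sum_zero (N : nat) (t : R) : odd_sum (fun _ => 0) N t = 0.
Proof.
  induction N as [|N IH]; [unfold odd_sum; rewrite sum_O; ring|].
  rewrite odd_sum_S, IH; ring.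
Qed.

(* Remainders after [N + 1] terms of the power series, at [x = sin t], of
   [1 / sqrt (1 - x ^ 2)] (times [cos t]), of [arcsin x], and of
   [arcsin x ^ 2 / (2 sqrt (1 - x ^ 2))] (times [cos t]). *)
Definition rem0 (N : nat) (t : R) : R := 1 - cos_even cb N t.
Definition rem1 (N : nat) (t : R) : R :=
  t - odd_sum (fun k => cb k / (2 * INR k + 1)) N t.
Definition rem2 (N : nat) (t : R) : R := t ^ 2 / 2 - cos_even cG N t.

Lemma is_derive_rem0 (N : nat) (t : R) :
  is_derive (rem0 N) t ((2 * INR N + 2) * cb (S N) * sin t ^ (2 * N + 1)).
Proof.
  replace (_ * _) with
    (0 - (odd_sum (fun k => (2 * INR k + 2) * cb (S k) - (2 * INR k + 1) * cb k) N t
     - (2 * INR N + 2) * cb (S N) * sin t ^ (2 * N + 1))).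
  - apply (is_derive_minus (fun _ => 1) (cos_even cb N)).
    + apply (is_derive_const 1).
    + apply is_derive_cos_even.
  - rewrite (odd_sum_ext _ (fun _ => 0)) by apply cb_rec.
    rewrite odd_sum_zero; ring.
Qed.

Lemma is_derive_rem1 (N : nat) (t : R) : is_derive (rem1 N) t (rem0 N t).
Proof.
  apply (is_derive_minus (fun t => t) (odd_sum _ N)).
  - apply (is_derive_id t).
  - apply is_derive_odd_sum.
Qed.

Lemma is_derive_rem2 (N : nat) (t : R) :
  is_derive (rem2 N) t
    (rem1 N t + (2 * INR N + 2) * cG (S N) * sin t ^ (2 * N + 1)).
Proof.
  replace (_ + _) with
    (t - (odd_sum (fun k => (2 * INR k + 2) * cG (S k) - (2 * INR k + 1) * cG k) N t
     - (2 * INR N + 2) * cG (S N) * sin t ^ (2 * N + 1))).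
  - apply (is_derive_minus (fun t => t ^ 2 / 2) (cos_even cG N)).
    + auto_derive; [exact I | field].
    + apply is_derive_cos_even.
  - rewrite (odd_sum_ext _ (fun k => cb k / (2 * INR k + 1))) by apply cG_rec.
    unfold rem1; ring.
Qed.

Lemma cG_ge_0 (k : nat) : 0 <= cG k.
Proof. apply Rmult_le_pos; [left; apply cb_pos | apply G_ge_0]. Qed.

Lemma cG_S_le (k : nat) : cG (S k) <= 2 * cb (S k).
Proof.
  unfold cG. assert (H := cb_pos (S k)). assert (H1 := G_S_le k).
  assert (0 < / (INR k + 1))
    by (apply Rinv_0_lt_compat; assert (H2 := pos_INR k); lra).
  nra.
Qed.

Lemma rem0_0 (N : nat) : rem0 N 0 = 0.
Proof. unfold rem0; rewrite cos_even_0, cb_0; ring. Qed.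

Lemma rem1_0 (N : nat) : rem1 N 0 = 0.
Proof. unfold rem1; rewrite odd_sum_0; ring. Qed.

Lemma rem2_0 (N : nat) : rem2 N 0 = 0.
Proof. unfold rem2; rewrite cos_even_0; unfold cG, G; field. Qed.

Lemma sin_ge_0_quarter (t : R) : 0 <= t <= PI / 2 -> 0 <= sin t.
Proof. intros H; assert (Hpi := PI_RGT_0); apply sin_ge_0; lra. Qed.

(** All three remainders vanish at 0. Positivity passes from the derivative of [rem0] up to [rem1],
    whose derivative is [rem0], and then to [rem2], whose derivative is [rem1] plus a nonnegative
    term. *)
Lemma rem2_ge_0 (N : nat) (t : R) : 0 <= t <= PI / 2 -> 0 <= rem2 N t.
Proof.
  revert t; apply (nonneg_of_derive _ _ _ (is_derive_rem2 N) (rem2_0 N)).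
  assert (HN := pos_INR N).
  assert (Hs : forall t, 0 <= t <= PI / 2 -> 0 <= sin t ^ (2 * N + 1))
    by (intros; apply pow_le, sin_ge_0_quarter; assumption).
  intros t Ht; apply Rplus_le_le_0_compat.
  2: { assert (H := cG_ge_0 (S N)); apply Rmult_le_pos; [apply Rmult_le_pos; lra | auto]. }
  revert t Ht; apply (nonneg_of_derive _ _ _ (is_derive_rem1 N) (rem1_0 N)).
  apply (nonneg_of_derive _ _ _ (is_derive_rem0 N) (rem0_0 N)).
  intros t Ht.
  assert (H := cb_pos (S N)); apply Rmult_le_pos; [apply Rmult_le_pos; lra | auto].
Qed.

(** * Integrable upper bound for [rem2] *)

Lemma quarter_sub_le_cos (t : R) :
  0 <= t <= PI / 2 -> PI / 2 - t <= 3 * cos t.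
Proof.
  intros Ht; assert (H4 := PI_4); rewrite <- sin_shift.
  set (u := PI / 2 - t). assert (Hu : 0 <= u <= 2) by (unfold u; lra).
  (* On [[0, 2]], [sin u >= u - u ^ 3 / 6 >= u / 3], since [u ^ 2 <= 4]. *)
  destruct (pre_sin_bound u 0) as [H _]; try lra.
  unfold sin_approx, sin_term in H; simpl in H.
  field_simplify in H. nra.
Qed.

Lemma is_RInt_eq (f g : R -> R) (a b v : R) :
  (forall t, f t = g t) -> is_RInt f a b v -> is_RInt g a b v.
Proof. intros H; apply is_RInt_ext; intros t _; apply H. Qed.

Lemma is_RInt_FTC (F f : R -> R) (a b : R) :
  (forall t, is_derive F t (f t)) -> (forall t, ex_derive f t) ->
  is_RInt f a b (F b - F a).
Proof.
  intros HF Hf; apply (is_RInt_derive F f).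
  - intros; apply HF.
  - intros; apply (ex_derive_continuous f), Hf.
Qed.

(* With [u = PI / 2 - t], the function
   [- u * rem2 - u ^ 2 / 2 * rem1 - u ^ 3 / 6 * rem0] has derivative
   [rem2 - O(u sin ^ (2 * N + 1))]; since [u <= 3 cos t], a multiple of
   [sin ^ (2 * N + 2)] makes up for the error term. *)
Lemma rem2_le_derivative (N : nat) :
  exists dPhi : R -> R,
    is_RInt dPhi 0 (PI / 2) (3 * cG (S N) + 2 * cb (S N)) /\
    forall t, 0 <= t <= PI / 2 -> rem2 N t <= dPhi t.
Proof.
  set (K := 3 * cG (S N) + 2 * cb (S N)).
  set (Phi := fun t =>
    - (PI / 2 - t) * rem2 N t - (PI / 2 - t) ^ 2 / 2 * rem1 N t
    - (PI / 2 - t) ^ 3 / 6 * rem0 N t + K * sin t ^ S (2 * N + 1)).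
  set (dPhi := fun t =>
    rem2 N t + (2 * INR N + 2) * sin t ^ (2 * N + 1) *
      (K * cos t - (PI / 2 - t) * cG (S N) - (PI / 2 - t) ^ 3 / 6 * cb (S N))).
  assert (E0 : forall t, ex_derive (rem0 N) t) by (eexists; apply is_derive_rem0).
  assert (E1 : forall t, ex_derive (rem1 N) t) by (eexists; apply is_derive_rem1).
  assert (E2 : forall t, ex_derive (rem2 N) t) by (eexists; apply is_derive_rem2).
  exists dPhi; split.
  - replace K with (Phi (PI / 2) - Phi 0).
    + apply is_RInt_FTC; intros t.
      * assert (H0 := is_derive_unique _ _ _ (is_derive_rem0 N t)).
        assert (H1 := is_derive_unique _ _ _ (is_derive_rem1 N t)).
        assert (H2 := is_derive_unique _ _ _ (is_derive_rem2 N t)).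
        assert (HS : INR (S (2 * N + 1)) = 2 * INR N + 2)
          by (rewrite S_INR, plus_INR, mult_INR; simpl (INR 2); simpl (INR 1); ring).
        unfold Phi, dPhi; remember (2 * N + 1)%nat as q eqn:Hq.
        auto_derive; [repeat split; auto|].
        (* The [match] is [INR (S q)] as unfolded by [auto_derive]; folding it back lets [HS]
           rewrite. *)
        change (match q with O => 1 | S _ => INR q + 1 end) with (INR (S q)).
        change (Derive (fun x => rem0 N x) t) with (Derive (rem0 N) t).
        change (Derive (fun x => rem1 N x) t) with (Derive (rem1 N) t).
        change (Derive (fun x => rem2 N x) t) with (Derive (rem2 N) t).
        rewrite H0, H1, H2, HS; field.
      * unfold dPhi; auto_derive; repeat split; auto.
    (* The remainders vanish at 0 and the powers of [PI / 2 - t] vanish at [PI / 2], so only [K]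
       survives. *)
    + unfold Phi. rewrite rem0_0, rem1_0, rem2_0, sin_0, sin_PI2, pow1, pow_ne_zero by lia.
      field.
  - intros t Ht; unfold dPhi, K.
    assert (Hs := pow_le _ (2 * N + 1) (sin_ge_0_quarter t Ht)).
    assert (Hu := quarter_sub_le_cos t Ht).
    assert (Hc := cG_ge_0 (S N)). assert (Hb := cb_pos (S N)).
    assert (HN := pos_INR N). assert (H4 := PI_4).
    set (u := PI / 2 - t) in *. assert (Hu2 : 0 <= u <= 2) by (unfold u; lra).
    (* From [u ^ 2 <= 4] and [u <= 3 cos t]. These two bounds supply the coefficients 2 and 3 in
       [K], making the bracket in [dPhi] nonnegative. *)
    assert (u ^ 3 / 6 <= 2 * cos t) by nra.
    rewrite <- (Rplus_0_r (rem2 N t)) at 1.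
    apply Rplus_le_compat_l, Rmult_le_pos; [apply Rmult_le_pos; lra|].
    nra.
Qed.

(** * From the series to an integral *)

Lemma is_RInt_sin_pow_cos (m : nat) :
  is_RInt (fun t => INR (S m) * sin t ^ m * cos t) 0 (PI / 2) 1.
Proof.
  replace 1 with (sin (PI / 2) ^ S m - sin 0 ^ S m)
    by (rewrite sin_PI2, sin_0, pow1, pow_ne_zero by lia; ring).
  apply (is_RInt_FTC (fun t => sin t ^ S m)); intros t.
  - apply is_derive_sin_pow.
  - auto_derive; exact I.
Qed.

Lemma is_RInt_cos_even (x : nat -> R) (n N : nat) :
  is_RInt (fun t => cos_even x N t * sin t ^ n) 0 (PI / 2)
    (sum_n (fun k => x k / (2 * INR k + 1 + INR n)) N).
Proof.
  assert (Hk : forall k, is_RInt (fun t => cos t * (x k * sin t ^ (2 * k)) * sin t ^ n)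
                 0 (PI / 2) (x k / (2 * INR k + 1 + INR n))).
  { intros k. assert (H := pos_INR k). assert (H' := pos_INR n).
    assert (HS : INR (S (2 * k + n)) = 2 * INR k + 1 + INR n)
      by (rewrite S_INR, plus_INR, mult_INR; simpl (INR 2); ring).
    rewrite <- (Rmult_1_r (x k / _)).
    apply (is_RInt_eq (fun t => x k / (2 * INR k + 1 + INR n)
             * (INR (S (2 * k + n)) * sin t ^ (2 * k + n) * cos t))).
    - intros t; rewrite HS, pow_add; field; lra.
    - apply (is_RInt_scal (V := R_NormedModule)), is_RInt_sin_pow_cos. }
  induction N as [|N IH].
  - rewrite sum_O; apply (is_RInt_eq (fun t => cos t * (x O * sin t ^ (2 * 0)) * sin t ^ n)); [|apply Hk].
    intros t; unfold cos_even; rewrite sum_O; reflexivity.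
  - rewrite sum_Sn.
    apply (is_RInt_eq (fun t => cos_even x N t * sin t ^ n
             + cos t * (x (S N) * sin t ^ (2 * S N)) * sin t ^ n)).
    + intros t; rewrite cos_even_S.
      replace (2 * S N)%nat with (S (S (2 * N))) by lia. ring.
    + apply (is_RInt_plus (V := R_NormedModule)); [exact IH | apply Hk].
Qed.

(** Integrating [rem2 N t * sin t ^ n] gives exactly [v] minus the partial sum, so the bounds on
    [rem2] squeeze the partial sums towards [v]. *)
Lemma is_series_of_is_RInt (n : nat) (v : R) :
  is_RInt (fun t => t ^ 2 / 2 * sin t ^ n) 0 (PI / 2) v ->
  is_series (fun k => cG k / (2 * INR k + 1 + INR n)) v.
Proof.
  intros Hv.
  set (u := fun N => sum_n (fun k => cG k / (2 * INR k + 1 + INR n)) N : R).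
  change (is_lim_seq u v).
  assert (Hpi := PI_RGT_0).
  assert (Hr : forall N, is_RInt (fun t => rem2 N t * sin t ^ n) 0 (PI / 2)
     (v - u N)).
  { intros N.
    apply (is_RInt_eq (fun t => t ^ 2 / 2 * sin t ^ n - cos_even cG N t * sin t ^ n)).
    - intros t; unfold rem2; ring.
    - apply (is_RInt_minus (V := R_NormedModule)); [exact Hv | apply is_RInt_cos_even]. }
  (* The 8 is [3 * 2 + 2]: [cG_S_le] bounds [3 cG (S N) + 2 cb (S N)] by [8 cb (S N)]. *)
  apply (is_lim_seq_le_le (fun N => v - 8 * cb (S N)) _ (fun _ => v)).
  - intros N; split.
    + destruct (rem2_le_derivative N) as [dPhi [HI Hle]].
      assert (H := is_RInt_le _ _ 0 (PI / 2) _ _ ltac:(lra) (Hr N) HI).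
      assert (Hc := cG_S_le N).
      enough (v - u N
                <= 3 * cG (S N) + 2 * cb (S N)) by lra.
      apply H; intros t Ht.
      apply Rle_trans with (2 := Hle t ltac:(lra)).
      rewrite <- (Rmult_1_r (rem2 N t)) at 2.
      apply Rmult_le_compat_l; [apply rem2_ge_0; lra|].
      rewrite <- (pow1 n); apply pow_incr; split;
        [apply sin_ge_0_quarter; lra | apply SIN_bound].
    + assert (H0 := is_RInt_const (V := R_NormedModule) 0 (PI / 2) 0).
      assert (H := is_RInt_le _ _ 0 (PI / 2) _ _ ltac:(lra) H0 (Hr N)).
      enough (0 <= v - u N) by lra.
      rewrite <- (Rmult_0_r (PI / 2 - 0)); apply H; intros t Ht.
      apply Rmult_le_pos; [apply rem2_ge_0 | apply pow_le, sin_ge_0_quarter]; lra.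
  - replace (Finite v) with (Finite (v - 8 * 0)) by (f_equal; ring).
    apply is_lim_seq_minus'; [apply is_lim_seq_const|].
    apply (is_lim_seq_scal_l (fun N => cb (S N)) 8 0).
    apply -> is_lim_seq_incr_1; apply is_lim_seq_cb.
  - apply is_lim_seq_const.
Qed.

(** * Reduction formulas lowering the exponent by 2 *)

Lemma pythagorean_defect (t : R) : 1 - sin t ^ 2 - cos t ^ 2 = 0.
Proof. assert (H := sin2_cos2 t); unfold Rsqr in H; lra. Qed.

(** Integration by parts in the form of an explicit antiderivative [F] of the defect [f]; [F]
    vanishes at both endpoints. *)
Lemma is_RInt_sin_pow_SS (n : nat) (w : R) :
  is_RInt (fun t => sin t ^ n) 0 (PI / 2) w ->
  is_RInt (fun t => sin t ^ S (S n)) 0 (PI / 2) ((INR n + 1) / (INR n + 2) * w).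
Proof.
  intros Hw; assert (Hn := pos_INR n).
  set (F := fun t => - (sin t ^ S n * cos t) / (INR n + 2)).
  set (f := fun t => sin t ^ S (S n) - (INR n + 1) / (INR n + 2) * sin t ^ n).
  assert (HF : is_RInt f 0 (PI / 2) (F (PI / 2) - F 0)).
  { apply is_RInt_FTC; intros t; unfold F, f; [|auto_derive; exact I].
    auto_derive; [exact I|].
    change (match n with O => 1 | S _ => INR n + 1 end) with (INR (S n)).
    rewrite S_INR; apply Rminus_diag_uniq.
    transitivity (sin t ^ n * (INR n + 1) / (INR n + 2)
                  * (1 - sin t ^ 2 - cos t ^ 2)).
    - simpl; field; lra.
    - rewrite pythagorean_defect; ring. }
  replace (_ * w) with ((F (PI / 2) - F 0) + (INR n + 1) / (INR n + 2) * w).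
  - apply (is_RInt_eq (fun t => f t + (INR n + 1) / (INR n + 2) * sin t ^ n)).
    + intros t; unfold f; simpl; ring.
    + apply (is_RInt_plus (V := R_NormedModule)); [exact HF|].
      apply (is_RInt_scal (V := R_NormedModule)), Hw.
  - unfold F; rewrite sin_0, cos_PI2, pow_ne_zero by lia; field; lra.
Qed.

Lemma is_RInt_sqr_sin_pow_SS (n : nat) (v w : R) :
  is_RInt (fun t => t ^ 2 / 2 * sin t ^ n) 0 (PI / 2) v ->
  is_RInt (fun t => sin t ^ S (S n)) 0 (PI / 2) w ->
  is_RInt (fun t => t ^ 2 / 2 * sin t ^ S (S n)) 0 (PI / 2)
    ((INR n + 1) / (INR n + 2) * v + (PI / 2 - w) / (INR n + 2) ^ 2).
Proof.
  intros Hv Hw; assert (Hn := pos_INR n).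
  (* The first summand cancels the cross term [t sin ^ (n + 1) cos] produced by differentiating
     [t ^ 2 / 2] in the second. Its value at [PI / 2] is the source of the [PI / 2] in the
     conclusion. *)
  set (F := fun t => (t * sin t ^ S (S n) / (INR n + 2) - t ^ 2 / 2 * (sin t ^ S n * cos t))
                     / (INR n + 2)).
  set (f := fun t => t ^ 2 / 2 * sin t ^ S (S n)
              - (INR n + 1) / (INR n + 2) * (t ^ 2 / 2 * sin t ^ n)
              + / (INR n + 2) ^ 2 * sin t ^ S (S n)).
  assert (HF : is_RInt f 0 (PI / 2) (F (PI / 2) - F 0)).
  { apply is_RInt_FTC; intros t; unfold F, f; [|auto_derive; exact I].
    auto_derive; [exact I|].
    change (match n with O => 1 | S _ => INR n + 1 end) with (INR (S n)).
    rewrite S_INR; apply Rminus_diag_uniq.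
    transitivity (t ^ 2 / 2 * sin t ^ n * (INR n + 1) / (INR n + 2)
                  * (1 - sin t ^ 2 - cos t ^ 2)).
    - simpl; field; lra.
    - rewrite pythagorean_defect; ring. }
  replace (_ + _) with ((F (PI / 2) - F 0 + (INR n + 1) / (INR n + 2) * v)
                        - / (INR n + 2) ^ 2 * w).
  - apply (is_RInt_eq (fun t => (f t + (INR n + 1) / (INR n + 2) * (t ^ 2 / 2 * sin t ^ n))
                                 - / (INR n + 2) ^ 2 * sin t ^ S (S n))).
    + intros t; unfold f; ring.
    + apply (is_RInt_minus (V := R_NormedModule));
        [apply (is_RInt_plus (V := R_NormedModule)); [exact HF|] |];
        apply (is_RInt_scal (V := R_NormedModule)); assumption.
  - unfold F; rewrite sin_PI2, cos_PI2, sin_0, !pow1, (pow_ne_zero (S (S n))) by lia.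
    field; lra.
Qed.

(** * Wallis integrals and the two closed forms *)

Lemma is_RInt_sin_pow_even (m : nat) :
  is_RInt (fun t => sin t ^ (2 * m)) 0 (PI / 2) (PI / 2 * cb m).
Proof.
  induction m as [|m IH].
  - rewrite cb_0. replace (PI / 2 * 1) with ((PI / 2 - 0) * 1) by ring.
    apply (is_RInt_const (V := R_NormedModule) 0 (PI / 2) 1).
  - apply is_RInt_sin_pow_SS in IH.
    replace (2 * S m)%nat with (S (S (2 * m))) by lia.
    assert (H := pos_INR m).
    replace (PI / 2 * cb (S m)) with
      ((INR (2 * m) + 1) / (INR (2 * m) + 2) * (PI / 2 * cb m)); [exact IH|].
    rewrite cb_S, mult_INR; simpl (INR 2); field; lra.
Qed.

Lemma is_RInt_sin_pow_odd (m : nat) :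
  is_RInt (fun t => sin t ^ (2 * m + 1)) 0 (PI / 2) (/ ((2 * INR m + 1) * cb m)).
Proof.
  induction m as [|m IH].
  - rewrite cb_0.
    replace (/ _) with (- cos (PI / 2) - - cos 0)
      by (rewrite cos_0, cos_PI2; simpl; field).
    apply (is_RInt_FTC (fun t => - cos t)); intros t; auto_derive;
      [exact I | simpl; ring | exact I].
  - apply is_RInt_sin_pow_SS in IH.
    replace (2 * S m + 1)%nat with (S (S (2 * m + 1))) by lia.
    assert (H := pos_INR m). assert (Hc := cb_pos m).
    replace (/ _) with ((INR (2 * m + 1) + 1) / (INR (2 * m + 1) + 2)
                        * / ((2 * INR m + 1) * cb m)); [exact IH|].
    rewrite cb_S, S_INR, plus_INR, mult_INR; simpl (INR 2); simpl (INR 1).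
    field; lra.
Qed.

(** The reduction factor [(2 m + 1) / (2 m + 2)] is [cb (S m) / cb m], so after division by [cb] the
    recurrence becomes a plain sum. Its increment is [PI / 8 * (/ cb (S m) - 1) / (m + 1) ^ 2]. *)
Lemma is_RInt_sqr_sin_pow_even (m : nat) :
  is_RInt (fun t => t ^ 2 / 2 * sin t ^ (2 * m)) 0 (PI / 2)
    (cb m / 8 * (PI ^ 3 / 6 +
       PI * sum_n_m (fun j => (/ cb j - 1) * (1 / INR j ^ 2)) 1 m)).
Proof.
  induction m as [|m IH].
  - rewrite cb_0, sum_n_m_zero by lia; change zero with 0.
    replace (_ * _) with ((PI / 2) ^ 3 / 6 - 0 ^ 3 / 6) by field.
    apply (is_RInt_FTC (fun t => t ^ 3 / 6)); intros t; auto_derive;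
      [exact I | simpl; field | exact I].
  - assert (Hw := is_RInt_sin_pow_even (S m)).
    replace (2 * S m)%nat with (S (S (2 * m))) in * by lia.
    assert (Hv := is_RInt_sqr_sin_pow_SS _ _ _ IH Hw).
    assert (H := pos_INR m). assert (Hc := cb_pos m).
    rewrite sum_n_Sm by lia. change plus with Rplus.
    set (s := sum_n_m _ _ _) in *.
    match goal with |- is_RInt _ _ _ ?x =>
      match type of Hv with is_RInt _ _ _ ?y => replace x with y; [exact Hv|] end end.
    rewrite cb_S, !S_INR, mult_INR; simpl (INR 2).
    field; lra.
Qed.

(** Here the prefactor is the odd Wallis integral itself, which obeys the same reduction factor.
    Dividing [PI / 2 - w] by [w] adds one term to each of the two sums. *)
Lemma is_RInt_sqr_sin_pow_odd (m : nat) :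
  is_RInt (fun t => t ^ 2 / 2 * sin t ^ (2 * m + 1)) 0 (PI / 2)
    (/ ((2 * INR m + 1) * cb m) *
       (PI / 2 * sum_n (fun j => cb j / (2 * INR j + 1)) m -
        sum_n (fun j => 1 / (2 * INR j + 1) ^ 2) m)).
Proof.
  induction m as [|m IH].
  - rewrite !sum_O, cb_0.
    set (F := fun t => - (t ^ 2 / 2) * cos t + t * sin t + cos t).
    replace (_ * _) with (F (PI / 2) - F 0)
      by (unfold F; rewrite sin_PI2, cos_PI2, cos_0; simpl; field).
    apply (is_RInt_FTC F); intros t; unfold F; auto_derive;
      [exact I | simpl; field | exact I].
  - assert (Hw := is_RInt_sin_pow_odd (S m)).
    replace (2 * S m + 1)%nat with (S (S (2 * m + 1))) in * by lia.
    assert (Hv := is_RInt_sqr_sin_pow_SS _ _ _ IH Hw).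
    assert (H := pos_INR m). assert (Hc := cb_pos m).
    rewrite !sum_Sn. change plus with Rplus.
    set (s := sum_n _ _) in *. set (s' := sum_n _ _) in *.
    match goal with |- is_RInt _ _ _ ?x =>
      match type of Hv with is_RInt _ _ _ ?y => replace x with y; [exact Hv|] end end.
    rewrite cb_S, !S_INR, plus_INR, mult_INR; simpl (INR 2); simpl (INR 1).
    field; lra.
Qed.

(** * Return to binomial coefficients *)

Lemma binom_central (k : nat) : binom (2 * k) k = cb k * 4 ^ k.
Proof. unfold cb; field; apply pow_nonzero; lra. Qed.

Lemma series_term (n k : nat) :
  cG k / (2 * INR k + 1 + INR n) =
  (binom (2 * k) k * G k) / (4 ^ k * (2 * INR k + 1 + INR n)).
Proof.
  unfold cG; rewrite binom_central.
  assert (H := pos_INR k). assert (H' := pos_INR n).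
  field; split; [lra | apply pow_nonzero; lra].
Qed.

Theorem corollary6p3 :
  (forall n : nat, Nat.Even n ->
     is_series
       (fun k : nat =>
          (binom (2 * k) k * G k) / (4 ^ k * (2 * INR k + 1 + INR n)))
       (binom n (n / 2) / 2 ^ (n + 3) *
          (PI ^ 3 / 6 +
           PI * sum_n_m
                  (fun j : nat =>
                     (4 ^ j / binom (2 * j) j - 1) * (1 / INR j ^ 2))
                  1 (n / 2))))
  /\
  (forall n : nat, Nat.Odd n ->
     is_series
       (fun k : nat =>
          (binom (2 * k) k * G k) / (4 ^ k * (2 * INR k + 1 + INR n)))
       (2 ^ (n - 1) / (INR n * binom (n - 1) ((n - 1) / 2)) *
          (PI / 2 *
             sum_n (fun j : nat =>
                      binom (2 * j) j / ((2 * INR j + 1) * 4 ^ j))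
                   ((n - 1) / 2) -
           sum_n (fun j : nat => 1 / (2 * INR j + 1) ^ 2) ((n - 1) / 2)))).
Proof.
  split; intros n [m ->].
  - apply (is_series_ext _ _ _ (series_term _)), is_series_of_is_RInt.
    replace (2 * m / 2)%nat with m by (symmetry; rewrite Nat.mul_comm; apply Nat.div_mul; lia).
    assert (H4 : 4 ^ m <> 0) by (apply pow_nonzero; lra).
    replace (binom (2 * m) m / 2 ^ (2 * m + 3)) with (cb m / 8).
    2: { rewrite binom_central, pow_add, pow_mult.
         replace (2 ^ 2) with 4 by ring. field; exact H4. }
    erewrite sum_n_m_ext; [apply is_RInt_sqr_sin_pow_even|].
    intros j; rewrite binom_central; assert (Hj := cb_pos j).
    assert (4 ^ j <> 0) by (apply pow_nonzero; lra).
    (* [sum_n_m_ext] asks for equality at every [j], including [j = 0] outside the range. Stripping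
       the common factor [1 / INR j ^ 2] first avoids having to show [INR j <> 0]. *)
    simpl; f_equal; f_equal. field; split; lra.
  - apply (is_series_ext _ _ _ (series_term _)), is_series_of_is_RInt.
    replace (2 * m + 1 - 1)%nat with (2 * m)%nat by lia.
    replace (2 * m / 2)%nat with m by (symmetry; rewrite Nat.mul_comm; apply Nat.div_mul; lia).
    assert (H4 : 4 ^ m <> 0) by (apply pow_nonzero; lra).
    assert (Hm := pos_INR m). assert (Hc := cb_pos m).
    replace (2 ^ (2 * m) / (INR (2 * m + 1) * binom (2 * m) m))
      with (/ ((2 * INR m + 1) * cb m)).
    2: { rewrite binom_central, pow_mult, plus_INR, mult_INR; simpl (INR 2); simpl (INR 1).
         replace (2 ^ 2) with 4 by ring. field; repeat split; lra. }
    erewrite (sum_n_ext (fun j => binom (2 * j) j / _)); [apply is_RInt_sqr_sin_pow_odd|].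
    intros j; rewrite binom_central; assert (Hj := pos_INR j).
    assert (4 ^ j <> 0) by (apply pow_nonzero; lra).
    simpl; field; split; lra.
Qed.
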